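(* The system of $5$ lines passing through the pairs of antipodal vertices of the convex regular $10$-gon (centred at the origin) is the unique maximum biangular line system in $\mathbb{R}^2$: every biangular line system in $\mathbb{R}^2$ has at most $5$ lines, and every biangular line system in $\mathbb{R}^2$ with exactly $5$ lines is the image of this one under an isometry of $\mathbb{R}^2$ fixing the origin.
   Context: For a finite set $\mathcal{X}\subset\mathbb{R}^d$ of unit vectors put $A(\mathcal{X}):=\{\langle x,x'\rangle\colon x\neq x';\ x,x'\in\mathcal{X}\}$. The set $\mathcal{X}$ spans a system of biangular lines (the lines through the origin in the directions $x\in\mathcal{X}$) if $-1\notin A(\mathcal{X})$ and $|\{\gamma^2\colon\gamma\in A(\mathcal{X})\}|\leq 2$. The number of lines is $|\mathcal{X}|$. *)

(* Defs.v *)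
From mathcomp Require Import all_boot all_order all_algebra finmap.
From mathcomp Require Import all_classical all_reals all_analysis.

Set Implicit Arguments.
Unset Strict Implicit.
Unset Printing Implicit Defensive.

Import Order.TTheory GRing.Theory Num.Theory.

Local Open Scope fset_scope.
Local Open Scope classical_set_scope.
Local Open Scope ring_scope.

(* The norm `|x| that MathComp-Analysis puts on matrices is the sup norm, so
   the Euclidean structure on R^d, represented by row vectors, is set up here. *)
Section Euclidean.
Context {R : realType} {d : nat}.
Implicit Types (x y : 'rV[R]_d) (X : {fset 'rV[R]_d}).

Definition dotp x y : R := (x *m y^T) 0 0.

Definition enorm x : R := Num.sqrt (dotp x x).

Definition euclidean_isometry (f : 'rV[R]_d -> 'rV[R]_d) : Prop :=
  forall x y, enorm (f x - f y) = enorm (x - y).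

Definition inner_products X : {fset R} :=
  [fset dotp x y | x in X, y in X & x != y].

Definition biangular X : Prop :=
  [/\ {in X, forall x, enorm x = 1},
      -1 \notin inner_products X
    & (#|` [fset g ^+ 2 | g in inner_products X] | <= 2)%N].

Definition line_through x y : set 'rV[R]_d :=
  [set (1 - t) *: x + t *: y | t in [set: R]].

Definition lines_of X : set (set 'rV[R]_d) :=
  [set line_through 0 x | x in [set` X]].

Definition antipodal_lines (V : set 'rV[R]_d) : set (set 'rV[R]_d) :=
  [set l | exists v w, [/\ V v, V w, w = - v & l = line_through v w]].

End Euclidean.

(* The convex regular n-gon centred at the origin with circumradius
   r and one vertex at polar angle a. *)
Definition regular_polygon_vertices {R : realType} (n : nat) (r a : R) :
    set 'rV[R]_2 :=
  [set \row_(i < 2) (r * (if i == 0 then cos (a + 2 * pi * k%:R / n%:R)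
                          else sin (a + 2 * pi * k%:R / n%:R)))
     | k in `I_n].

(* Main.v *)
(* Identify the plane with the complex numbers and square: the lines become
   distinct points of a circle, and the squared inner product of two unit
   vectors [x], [y] determines [x^2 / y^2] up to conjugation. Hence all
   quotients of two such points lie in a set [T] of at most five numbers (1 and
   two conjugate pairs), which gives the bound. With five points, multiplication
   by any [t] in [T] permutes them, so [t^5 = 1]: the squares form a regular
   pentagon, and the lines are those of the regular 10-gon. *)
Require Import Defs.
From mathcomp Require Import all_boot all_order all_algebra finmap.
From mathcomp Require Import all_classical all_reals all_analysis.
From mathcomp Require Import complex ring lra.

Set Implicit Arguments.
Unset Strict Implicit.
Unset Printing Implicit Defensive.

Import Order.TTheory GRing.Theory Num.Theory.

Local Open Scope fset_scope.
Local Open Scope classical_set_scope.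
Local Open Scope ring_scope.

(** * Finite subsets of a field with few quotients *)

Section QuotientSets.
Context {F : fieldType} (S T : seq F).
Hypotheses (uniqS : uniq S) (S0 : 0 \notin S)
  (divST : {in S &, forall w0 w, w / w0 \in T}).

Let divS_uniq w0 : w0 \in S -> uniq [seq w / w0 | w <- S].
Proof.
move=> w0S; rewrite map_inj_uniq //; apply: mulIf.
by rewrite invr_eq0; apply: contraNneq S0 => <-.
Qed.

Let divS_sub w0 : w0 \in S -> {subset [seq w / w0 | w <- S] <= T}.
Proof. by move=> w0S _ /mapP[w wS ->]; exact: divST. Qed.

(** Division by one fixed element of [S] is injective and lands in [T]. *)
Lemma size_quotients : (size S <= size T)%N.
Proof.
case: (posnP (size S)) => [-> //|S_gt0].
have w0S : S`_0 \in S by rewrite mem_nth.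
rewrite -(size_map (fun w => w / S`_0)) uniq_leq_size ?divS_uniq //.
exact: divS_sub.
Qed.

Hypothesis sizeST : size S = size T.

(** With equal sizes the injection of [S] into [T] is onto, whichever element [w0] one divides
    by. *)
Lemma mem_quotients w0 : w0 \in S -> [seq w / w0 | w <- S] =i T.
Proof.
move=> w0S; have [|//] := uniq_min_size (divS_uniq w0S) (divS_sub w0S).
by rewrite size_map sizeST.
Qed.

Lemma quotients_uniq : uniq T.
Proof.
case: (posnP (size S)) => [S_nil|S_gt0].
  by move: S_nil; rewrite sizeST => /size0nil ->.
have w0S : S`_0 \in S by rewrite mem_nth.
by rewrite -(eq_uniq _ (mem_quotients w0S)) ?divS_uniq // size_map.
Qed.

(* [S] is stable under multiplication by [t], which therefore permutes it;
   compare the products of the elements of [S] before and after. *)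
Lemma quotients_unity_root t : t \in T -> t ^+ size S = 1.
Proof.
move=> tT.
have S_gt0 : (0 < size S)%N by rewrite sizeST; case: (T) tT.
have nz w : w \in S -> w != 0 by move=> wS; apply: contraNneq S0 => <-.
have mulS w : w \in S -> t * w \in S.
  move=> wS; have := tT; rewrite -(mem_quotients wS) => /mapP[v vS ->].
  by rewrite divfK ?nz.
have t0 : t != 0.
  have w0S : S`_0 \in S by rewrite mem_nth.
  by apply: contraNneq S0 => t0; have := mulS _ w0S; rewrite t0 mul0r.
have prodS0 : \prod_(w <- S) w != 0.
  by rewrite prodf_seq_neq0; apply/allP => w wS; exact: nz.
have tS_uniq : uniq [seq t * w | w <- S].
  by rewrite map_inj_uniq //; exact: mulfI.
have tS_perm : perm_eq [seq t * w | w <- S] S.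
  apply: uniq_perm => //; have [||//] := @uniq_min_size _ _ S tS_uniq.
  - by move=> _ /mapP[w wS ->]; exact: mulS.
  - by rewrite size_map.
apply: (mulIf prodS0); rewrite mul1r -{2}(perm_big _ tS_perm) /=.
rewrite big_map big_split /= big_const_seq count_predT.
by rewrite -Monoid.iteropE.
Qed.

(** [T] already holds [size S] distinct roots of unity of that order; one more would exceed the
    number of roots a polynomial of degree [size S] can have. *)
Lemma quotients_unity_roots t : (0 < size S)%N -> (t \in T) = (t ^+ size S == 1).
Proof.
move=> S_gt0; apply/idP/eqP => [|t1]; first exact: quotients_unity_root.
apply: contraT => tT.
have := @max_unity_roots _ _ (t :: T) S_gt0.
rewrite /= sizeST ltnn tT quotients_uniq -sizeST => -> //.
apply/andP; split; first by rewrite unity_rootE t1.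
by apply/allP => u uT; rewrite unity_rootE quotients_unity_root.
Qed.

End QuotientSets.

(** * The Euclidean plane as the complex numbers *)

Section Plane.
Context {R : realType}.
Implicit Types (x y : 'rV[R]_2) (z w u : R[i]) (X : {fset 'rV[R]_2}).

Definition cpx x : R[i] := (x 0 0 +i* x 0 1)%C.
Definition vec z : 'rV[R]_2 :=
  \row_(i < 2) (if i == 0 then complex.Re z else complex.Im z).

Lemma cpxK : cancel cpx vec.
Proof.
move=> x; apply/rowP => i; rewrite mxE.
case: ifP => [/eqP->//|]; case: i => [[|[|//]]] //= ? _.
by congr (x _ _); apply/val_inj.
Qed.

Lemma vecK : cancel vec cpx.
Proof. by move=> [a b]; rewrite /cpx !mxE. Qed.

Lemma cpx0 : cpx 0 = 0.
Proof. by rewrite /cpx !mxE. Qed.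

Lemma vec0 : vec 0 = 0.
Proof. by rewrite -cpx0 cpxK. Qed.

Lemma vecN z : vec (- z) = - vec z.
Proof. by case: z => a b; apply/rowP => i; rewrite !mxE; case: ifP. Qed.

Lemma cpxB x y : cpx (x - y) = cpx x - cpx y.
Proof. by rewrite /cpx !mxE. Qed.

Lemma vecB z w : vec (z - w) = vec z - vec w.
Proof. by apply: (can_inj cpxK); rewrite cpxB !vecK. Qed.

Lemma cpxZ a x : cpx (a *: x) = a%:C%C * cpx x.
Proof. by rewrite /cpx !mxE; simpc. Qed.

Lemma dotpE x y : dotp x y = x 0 0 * y 0 0 + x 0 1 * y 0 1.
Proof.
rewrite /dotp mxE big_ord_recl big_ord1 !mxE.
by congr (_ + x _ _ * y _ _); apply/val_inj.
Qed.

Lemma enorm_normc x : enorm x = ComplexField.Normc.normc (cpx x).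
Proof. by rewrite /enorm dotpE /= -!expr2. Qed.

Lemma normc_sqr z : ComplexField.Normc.normc z = 1 ->
  complex.Re z ^+ 2 + complex.Im z ^+ 2 = 1.
Proof.
case: z => a b /= z1; rewrite -[LHS]sqr_sqrtr ?addr_ge0 ?sqr_ge0 //.
by rewrite z1 expr1n.
Qed.

(** The inverse of a unit complex number is its conjugate, and [dotp x y] is the real part of
    [cpx x] times the conjugate of [cpx y]. *)
Lemma dotp_div x y : enorm y = 1 -> dotp x y = complex.Re (cpx x / cpx y).
Proof.
rewrite enorm_normc => /normc_sqr /= y1.
by rewrite dotpE /= y1 !divr1 mulrN opprK.
Qed.

(* When [z] is on the unit circle, [z ^ 2] is determined by the square [g] of
   its real part, up to conjugation. *)
Definition dbl (g : R) : R[i] :=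
  ((2 * g - 1) +i* (2 * Num.sqrt (g * (1 - g))))%C.

Lemma sqr_dbl z : ComplexField.Normc.normc z = 1 ->
  z ^+ 2 = dbl (complex.Re z ^+ 2) \/
  z ^+ 2 = ((dbl (complex.Re z ^+ 2))^*)%C.
Proof.
move=> /normc_sqr; case: z => a b /= ab1.
have {ab1} b2 : b ^+ 2 = 1 - a ^+ 2 by rewrite -ab1; ring.
rewrite /dbl -b2 -exprMn sqrtr_sqr.
have -> : (a +i* b)%C ^+ 2 = ((2 * a ^+ 2 - 1) +i* (2 * (a * b)))%C.
  rewrite expr2; simpc; congr (_ +i* _)%C; last by ring.
  by rewrite -!expr2 b2; ring.
(* The imaginary part of the square is [2 * (a * b)], while [dbl] now carries the absolute value of
   [a * b]: the sign chooses between [dbl] and its conjugate. *)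
case: (ger0P (a * b)) => _; [by left|right].
by rewrite /= mulrN opprK.
Qed.

(** Equal squares mean equal or opposite vectors; biangularity excludes the opposite ones, so
    squaring will be injective on the system. *)
Lemma eq_unit_sqr x y : enorm x = 1 -> enorm y = 1 ->
  cpx x ^+ 2 = cpx y ^+ 2 -> x = y \/ dotp x y = -1.
Proof.
move=> x1 y1 /eqP; rewrite eqf_sqr.
case/orP=> [/eqP/(can_inj cpxK)|/eqP xy]; first by left.
right; rewrite dotp_div // xy mulNr mulfV //.
apply/eqP => y0; move: y1; rewrite enorm_normc y0.
by rewrite ComplexField.Normc.normc0 => /eqP; rewrite eq_sym oner_eq0.
Qed.

(** * Squares of a biangular system and the bound 5 *)

Lemma mem_inner_products X x y : x \in X -> y \in X -> x != y ->
  dotp x y \in inner_products X.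
Proof.
move=> xX yX xy; apply/imfset2P; exists x => //; exists y => //.
by rewrite !inE yX.
Qed.

Lemma inner_productsP X g : g \in inner_products X ->
  exists x y, [/\ x \in X, y \in X, x != y & g = dotp x y].
Proof.
by case/imfset2P => x /= xX [y]; rewrite !inE => /andP[yX xy] ->; exists x, y.
Qed.

Lemma card_le2 (K : choiceType) (k0 : K) (G : {fset K}) : (#|` G| <= 2)%N ->
  exists a b, {subset G <= [:: a; b]}.
Proof.
(* [k0] fills in when [G] has fewer than two elements; only an inclusion is claimed. *)
move=> G2; exists (nth k0 G 0), (nth k0 G 1) => g gG.
rewrite -(nth_index k0 gG); have : (index g G < 2)%N.
  by apply: leq_trans G2; rewrite index_mem.
by case: index => [|[|//]] _; rewrite !inE eqxx ?orbT.
Qed.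

Definition squares X : seq R[i] := [seq cpx x ^+ 2 | x <- enum_fset X].

Lemma size_squares X : size (squares X) = #|` X|.
Proof. by rewrite size_map. Qed.

Lemma biangular_squares X : biangular X ->
  [/\ uniq (squares X), 0 \notin squares X &
      exists2 T : seq R[i], size T = 5%N &
        {in squares X &, forall w0 w, w / w0 \in T}].
Proof.
case=> X1 X_neg1 X_card; have nz x : x \in X -> cpx x != 0.
  move=> xX; apply/eqP => x0; have := X1 _ xX; rewrite enorm_normc x0.
  by rewrite ComplexField.Normc.normc0 => /eqP; rewrite eq_sym oner_eq0.
split.
- rewrite map_inj_in_uniq ?fset_uniq // => x y xX yX /eq_unit_sqr[||//|xy];
    [exact: X1|exact: X1|].
  have [//|x_neq_y] := eqVneq x y.
  by move: X_neg1; rewrite -xy mem_inner_products.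
- by apply/negP => /mapP[x xX /esym/eqP]; rewrite expf_eq0 /= (negPf (nz _ xX)).
have [a [b ab]] := card_le2 (0 : R) X_card.
(* The entry 1 serves the quotient of a square by itself, the conjugate pairs serve the two squared
   inner products. Entries may coincide: only the length of the list counts. *)
exists [:: 1; dbl a; (dbl a)^*%C; dbl b; (dbl b)^*%C] => //.
move=> _ _ /mapP[y yX ->] /mapP[x xX ->].
have [->|x_neq_y] := eqVneq x y.
  by rewrite mulfV ?mem_head // expf_eq0 nz.
have : dotp x y ^+ 2 \in [:: a; b].
  by apply/ab/imfsetP; exists (dotp x y) => //; exact: mem_inner_products.
rewrite -expr_div_n dotp_div ?X1 // => u_ab.
have [|->|->] := @sqr_dbl (cpx x / cpx y).
- rewrite ComplexField.Normc.normcM ComplexField.Normc.normcV.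
  by rewrite -!enorm_normc !X1 // divr1.
- by move: u_ab; rewrite !inE => /orP[] /eqP ->; rewrite eqxx ?orbT.
- by move: u_ab; rewrite !inE => /orP[] /eqP ->; rewrite eqxx ?orbT.
Qed.

Lemma biangular_card_le5 X : biangular X -> (#|` X| <= 5)%N.
Proof.
case/biangular_squares => S_uniq S0 [T <- ST].
by rewrite -size_squares; exact: size_quotients ST.
Qed.

(** * Lines through the origin and their images under complex multiplication *)

Lemma line_through0E x : line_through 0 x = [set t *: x | t in [set: R]].
Proof. by apply: eq_imagel => t _; rewrite scaler0 add0r. Qed.

Lemma line_through0Z (c : R) x : c != 0 ->
  line_through 0 (c *: x) = line_through 0 x.
Proof.
move=> c0; rewrite !line_through0E; apply/seteqP; split => _ [t _ <-].
  by exists (t * c); rewrite // scalerA.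
by exists (t / c); rewrite // scalerA divfK.
Qed.

Lemma line_through0N x : line_through 0 (- x) = line_through 0 x.
Proof. by rewrite -scaleN1r line_through0Z // oppr_eq0 oner_eq0. Qed.

Lemma line_throughN x : line_through x (- x) = line_through 0 x.
Proof.
rewrite line_through0E /line_through; apply/seteqP; split => _ [t _ <-].
  by exists (1 - 2 * t) => //; rewrite scalerN -scalerBl; congr (_ *: _); ring.
by exists ((1 - t) / 2) => //; rewrite scalerN -scalerBl; congr (_ *: _); field.
Qed.

Lemma image_line_through0 u x :
  [set vec (u * cpx y) | y in line_through 0 x] =
  line_through 0 (vec (u * cpx x)).
Proof.
have vecZ t : vec (u * cpx (t *: x)) = t *: vec (u * cpx x).
  by apply: (can_inj cpxK); rewrite cpxZ !vecK cpxZ vecK mulrCA.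
rewrite !line_through0E; apply/seteqP; split => [_ [_ [t _ <-] <-]|_ [t _ <-]].
  by exists t; rewrite // vecZ.
by exists (t *: x); rewrite ?vecZ //; exists t.
Qed.

Lemma mul_unit_isometry u : ComplexField.Normc.normc u = 1 ->
  euclidean_isometry (fun x => vec (u * cpx x)).
Proof.
move=> u1 x y; rewrite !enorm_normc -vecB vecK -mulrBr -cpxB.
by rewrite ComplexField.Normc.normcM u1 mul1r.
Qed.

(** * Tenth roots of unity and the regular 10-gon *)

Definition cis (t : R) : R[i] := (cos t +i* sin t)%C.

Lemma cisD s t : cis (s + t) = cis s * cis t.
Proof. by rewrite /cis cosD sinD; simpc; congr (_ +i* _)%C; rewrite addrC. Qed.

Lemma cisX t n : cis (t *+ n) = cis t ^+ n.
Proof.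
elim: n => [|n IHn]; first by rewrite mulr0n expr0 /cis cos0 sin0.
by rewrite mulrS exprS cisD IHn.
Qed.

Lemma normc_cis t : ComplexField.Normc.normc (cis t) = 1.
Proof. by rewrite /= cos2Dsin2 sqrtr1. Qed.

Lemma cis_neq0 t : cis t != 0.
Proof.
apply/eqP => t0; have := normc_cis t; rewrite t0.
by rewrite ComplexField.Normc.normc0 => /eqP; rewrite eq_sym oner_eq0.
Qed.

(** The rotation from one vertex of the 10-gon to the next. *)
Definition zeta : R[i] := cis (pi / 5).

Lemma zeta5 : zeta ^+ 5 = -1.
Proof.
rewrite -cisX -(mulr_natr (pi / 5)) divfK ?pnatr_eq0 // /cis cospi sinpi.
by apply/eqP; rewrite eq_complex /= oppr0 !eqxx.
Qed.

Lemma sin_pi5_gt0 m : (0 < m < 5)%N -> 0 < sin (pi / 5 *+ m : R).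
Proof.
case/andP => m0 m5; apply: sin_gt0_pi; have pi0 := pi_gt0 R.
have m0' : 0 < m%:R :> R by rewrite ltr0n.
have m5' : m%:R < 5 :> R by rewrite ltr_nat.
by rewrite -(mulr_natr (pi / 5)); apply/andP; split; nra.
Qed.

(** The order divides 10, and the proper divisors 1, 2, 5 are excluded: [zeta ^+ 5] is -1, and
    [zeta ^+ 2] has positive imaginary part. *)
Lemma zeta_prim : 10.-primitive_root zeta.
Proof.
have z10 : zeta ^+ 10 = 1 by rewrite (exprM _ 5 2) zeta5 sqrrN expr1n.
have z5_neq1 : zeta ^+ 5 != 1.
  by rewrite zeta5 eq_sym -addr_eq0 -(natrD _ 1 1) pnatr_eq0.
have z2_neq1 : zeta ^+ 2 != 1.
  rewrite -cisX eq_complex /= negb_and; apply/orP; right.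
  by rewrite gt_eqF // sin_pi5_gt0.
have [m m_prim m10] := prim_order_exists (isT : (0 < 10)%N) z10.
suff -> : 10%N = m by [].
have : m \in divisors 10 by rewrite -dvdn_divisors.
rewrite !inE => /or4P[]/eqP m_eq //; move: m_prim;
  rewrite m_eq => /prim_expr_order zm.
- by move: z2_neq1; rewrite expr2 -(expr1 zeta) zm mul1r eqxx.
- by rewrite zm eqxx in z2_neq1.
- by rewrite zm eqxx in z5_neq1.
Qed.

Lemma regular_10gonE (r a : R) : regular_polygon_vertices 10 r a =
  [set r *: vec (cis a * zeta ^+ k) | k in `I_10].
Proof.
rewrite /regular_polygon_vertices; apply: eq_imagel => k _.
rewrite -cisX -cisD; apply/rowP => i; rewrite !mxE /=.
have -> : a + 2 * pi * k%:R / 10 = a + pi / 5 *+ k.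
  by rewrite -[pi / 5 *+ k]mulr_natr; congr (_ + _); field.
by case: ifP.
Qed.

(** Indexing by all of [nat] lists each line repeatedly, but spares reductions modulo 10 later
    on. *)
Lemma antipodal_lines_10gon (r a : R) : 0 < r ->
  antipodal_lines (regular_polygon_vertices 10 r a) =
  [set line_through 0 (vec (cis a * zeta ^+ k)) | k in [set: nat]].
Proof.
move=> r0; rewrite regular_10gonE; apply/seteqP; split.
  move=> _ [_ [w [[k _ <-] _ -> ->]]]; exists k => //.
  by rewrite line_throughN line_through0Z // gt_eqF.
move=> _ [k _ <-].
set v := r *: vec (cis a * zeta ^+ k).
exists v, (- v); rewrite /v; split => //.
- exists (k %% 10)%N; first by rewrite /= ltn_pmod.
  by rewrite (prim_expr_mod zeta_prim).
(* The antipode is five vertices further, since [zeta ^+ 5] is -1. *)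
- exists ((k + 5) %% 10)%N; first by rewrite /= ltn_pmod.
  by rewrite (prim_expr_mod zeta_prim) exprD zeta5 mulrN1 mulrN vecN scalerN.
- by rewrite line_throughN line_through0Z // gt_eqF.
Qed.

(** * Rigidity of systems of five lines *)

(** The quotients of the squares by [cpx x0 ^+ 2] are exactly the fifth roots of unity, so the
    vectors are [cpx x0] times tenth roots of unity, and every such direction occurs up to sign. *)
Lemma lines_of_biangular5 X x0 : biangular X -> #|` X| = 5%N -> x0 \in X ->
  lines_of X =
    [set line_through 0 (vec (cpx x0 * zeta ^+ k)) | k in [set: nat]].
Proof.
move=> /biangular_squares[S_uniq S0 [T sizeT ST]] X5 x0X.
have sizeST : size (squares X) = size T by rewrite size_squares X5.
have x0S : cpx x0 ^+ 2 \in squares X by apply/mapP; exists x0.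
have z0 : cpx x0 != 0.
  by apply: contraNneq S0 => z0; move: x0S; rewrite z0 expr0n.
have memT t : (t \in T) = (t ^+ 5 == 1).
  by rewrite (quotients_unity_roots S_uniq S0 ST sizeST) ?size_squares X5.
apply/seteqP; split => [_ [x /= xX <-]|_ [k _ <-]].
  have : cpx x ^+ 2 / cpx x0 ^+ 2 \in T by apply: ST => //; apply/mapP; exists x.
  rewrite memT -expr_div_n -exprM => /eqP/(prim_rootP zeta_prim)[i zi].
  by exists i => //; rewrite -zi mulrC divfK // cpxK.
have : zeta ^+ k ^+ 2 \in T.
  by rewrite memT -(exprM _ 2 5) exprAC (prim_expr_order zeta_prim) expr1n.
rewrite -(mem_quotients S_uniq S0 ST sizeST x0S) => /mapP[_ /mapP[x xX ->]].
move/(canLR (divfK (expf_neq0 2 z0))); rewrite mulrC -exprMn => /eqP.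
(* The square fixes [cpx x] only up to sign, and both signs span the same line. *)
rewrite eqf_sqr => /orP[]/eqP eq_x; exists x => //.
  by rewrite eq_x cpxK.
by rewrite eq_x vecN line_through0N cpxK.
Qed.

(** * A biangular system of five lines *)

(** Five consecutive vertices of the 10-gon of circumradius 1, one from each antipodal pair. *)
Definition pentad (a : R) : {fset 'rV[R]_2} :=
  [fset vec (cis a * zeta ^+ nat_of_ord k) | k : 'I_5].

Lemma card_pentad a : #|` pentad a| = 5%N.
Proof.
rewrite card_imfset /= -?cardE ?card_ord //.
move=> j k /(can_inj vecK)/(mulfI (cis_neq0 a))/eqP.
rewrite (eq_prim_root_expr zeta_prim) !modn_small => [/eqP/val_inj//||];
  by apply: leq_trans (ltn_ord _) _.
Qed.

Lemma dotpC x y : dotp x y = dotp y x.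
Proof. by rewrite !dotpE mulrC (mulrC (x 0 1)). Qed.

Lemma dotp_cis s t : dotp (vec (cis s)) (vec (cis t)) = cos (s - t).
Proof. by rewrite dotpE !mxE /= cosB. Qed.

Lemma inner_products_pentad a g : g \in inner_products (pentad a) ->
  exists2 m, (0 < m < 5)%N & g = cos (pi / 5 *+ m).
Proof.
case/inner_productsP => _ [_ [/imfsetP[j _ ->] /imfsetP[k _ ->] jk ->]].
have {jk} : j != k by apply: contraNneq jk => ->.
rewrite -!cisX -!cisD; wlog kj : j k / (k <= j)%N => [wh jk|jk].
  case/orP: (leq_total k j) => kj; first exact: wh.
  by rewrite dotpC; apply: wh => //; rewrite eq_sym.
exists (j - k)%N.
  rewrite subn_gt0 ltn_neqAle kj eq_sym jk /=.
  by apply: leq_ltn_trans (leq_subr _ _) (ltn_ord _).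
by rewrite dotp_cis mulrnBr // opprD addrACA subrr add0r.
Qed.

Lemma biangular_pentad a : biangular (pentad a).
Proof.
split.
- move=> _ /imfsetP[k _ ->]; rewrite enorm_normc vecK -cisX -cisD.
  exact: normc_cis.
(* The angle has positive sine, so its cosine cannot be -1. *)
- apply/negP => /inner_products_pentad[m /sin_pi5_gt0 m_gt0 cos_m].
  have := cos2Dsin2 (pi / 5 *+ m : R); rewrite -cos_m; nra.
- apply: (@leq_trans #|` [fset cos (pi / 5 : R) ^+ 2; cos (pi / 5 *+ 2 : R) ^+ 2]|);
    last by rewrite cardfs2; case: eqP.
  apply: fsubset_leq_card; apply/fsubsetP => _ /imfsetP[g /= gX ->].
  (* Supplementary angles have opposite cosines, so the multiples 1 and 4 of [pi / 5] share a
     squared cosine, as do 2 and 3. *)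
  have cos_pi5B m : (m <= 5)%N ->
      cos (pi / 5 *+ m : R) ^+ 2 = cos (pi / 5 *+ (5 - m) : R) ^+ 2.
    move=> m5; rewrite mulrnBr // -(mulr_natr (pi / 5) 5) divfK ?pnatr_eq0 //.
    by rewrite cosB cospi sinpi mul0r addr0 mulN1r sqrrN.
  case/inner_products_pentad: gX => m m_lt ->; rewrite !inE.
  case: m m_lt => [|[|[|[|[|m]]]]] // _; rewrite ?mulr1n ?eqxx ?orbT //.
    by rewrite (cos_pi5B 3) // eqxx orbT.
  by rewrite (cos_pi5B 4) // eqxx.
Qed.

End Plane.

Theorem lemma2p1 (R : realType) (r a : R) (r_gt0 : 0 < r) :
  [/\ exists X : {fset 'rV[R]_2},
        [/\ biangular X, #|` X| = 5%N
          & lines_of X = antipodal_lines (regular_polygon_vertices 10 r a)],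
      forall X : {fset 'rV[R]_2}, biangular X -> (#|` X| <= 5)%N
    & forall X : {fset 'rV[R]_2}, biangular X -> #|` X| = 5%N ->
        exists f : 'rV[R]_2 -> 'rV[R]_2,
          [/\ euclidean_isometry f, f 0 = 0
            & lines_of X =
              [set f @` l | l in antipodal_lines (regular_polygon_vertices 10 r a)]]].
Proof.
split; last 1 first.
- move=> X X_biang X5.
  have [x0 x0X] : exists x0, x0 \in X by apply/fset0Pn; rewrite -cardfs_eq0 X5.
  (* The rotation taking the vertex direction [cis a] to [x0]. *)
  exists (fun x => vec (cpx x0 / cis a * cpx x)); split.
  + apply: mul_unit_isometry; case: X_biang => X1 _ _.
    rewrite ComplexField.Normc.normcM ComplexField.Normc.normcV normc_cis.
    by rewrite -enorm_normc X1 // divr1.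
  + by rewrite cpx0 mulr0 vec0.
  + rewrite (lines_of_biangular5 X_biang X5 x0X) antipodal_lines_10gon //.
    rewrite image_comp; apply: eq_imagel => k _ /=.
    by rewrite image_line_through0 vecK mulrA divfK ?cis_neq0.
- exists (pentad a); split; [exact: biangular_pentad|exact: card_pentad|].
  have x0P : vec (cis a) \in pentad a.
    by apply/imfsetP; exists ord0; rewrite //= expr0 mulr1.
  (* Rigidity, applied to the pentad with its vertex [cis a] as base point, already computes its
     lines. *)
  rewrite (lines_of_biangular5 (biangular_pentad a) (card_pentad a) x0P).
  by rewrite vecK antipodal_lines_10gon.
- exact: biangular_card_le5.
Qed.
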